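(* For every positive integer $n$ there exists a bijection $\Phi:\mathfrak{S}_n\to\mathfrak{S}_n$ such that for all $\pi\in\mathfrak{S}_n$, $$\bigl(F(\Phi(\pi)),\ \mathrm{sign}(\Phi(\pi)),\ \mathrm{ExcLen}(\Phi(\pi))\bigr)=\bigl(F(\pi),\ \mathrm{sign}(\pi),\ \mathrm{DescLen}(\pi)\bigr),$$ where $F:\mathfrak{S}_n\to\mathbb{Z}$ sends a permutation to its first letter.
   Context: $\mathfrak{S}_n$ is the set of permutations $\pi=\pi_1\pi_2\cdots\pi_n$ of $[n]=\{1,\dots,n\}$ in one-line notation, $F(\pi)=\pi_1$, and $\mathrm{sign}(\pi)$ is the usual sign $(-1)^{\mathrm{inv}(\pi)}$, with $\mathrm{inv}(\pi)=|\{(i,j):1\le i<j\le n,\ \pi_i>\pi_j\}|$. Define $$\mathrm{ExcLen}(\pi)=\sum_{i\in[n],\ \pi_i>i}(\pi_i-i),\qquad \mathrm{DescLen}(\pi)=\sum_{i\in[n-1],\ \pi_i>\pi_{i+1}}(\pi_i-\pi_{i+1}).$$ *)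

(* Defs.v *)
From mathcomp Require Import all_boot all_order all_fingroup all_algebra.
Set Implicit Arguments.
Unset Strict Implicit.
Unset Printing Implicit Defensive.

Section Statistics.
Variable n : nat.

(* Permutations of [n + 1] are elements of 'S_n.+1, i.e. permutations of
   {0, ..., n}: positions and letters are both shifted down by one.  Every
   statistic below except [first_letter] only depends on comparisons and
   differences, which the shift preserves. *)
Implicit Type pi : 'S_n.+1.

(* The successor undoes the shift: the result lies in {1, ..., n + 1}. *)
Definition first_letter pi : int := Posz (pi ord0).+1.

Definition inversions pi : {set 'I_n.+1 * 'I_n.+1} :=
  [set p : 'I_n.+1 * 'I_n.+1 | (p.1 < p.2) && (pi p.2 < pi p.1)].

Definition perm_inv pi : nat := #|inversions pi|.

Definition perm_sign pi : int := ((-1) ^+ perm_inv pi)%R.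

(* The truncated subtractions in the next two sums are exact, because of the
   conditions on the summation indices. *)
Definition ExcLen pi : nat := \sum_(i < n.+1 | i < pi i) (pi i - i).

(* For i < n, [widen_ord (leqnSn n) i] and [lift ord0 i] are the positions i
   and i + 1 as elements of 'I_n.+1. *)
Definition DescLen pi : nat :=
  \sum_(i < n | pi (lift ord0 i) < pi (widen_ord (leqnSn n) i))
     (pi (widen_ord (leqnSn n) i) - pi (lift ord0 i)).

End Statistics.

(* Main.v *)
Require Import Defs.
From mathcomp Require Import all_boot all_order all_fingroup all_algebra.
From mathcomp Require Import zify.

Set Implicit Arguments.
Unset Strict Implicit.
Unset Printing Implicit Defensive.

(** Words without repeated letters replace permutations throughout, since
deleting the first letter leaves a word on fewer letters and so allows
induction.  Two maps on words carry the proof.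

The map [word_perm] turns a word into a permutation.  Cut a word after each
right-to-left minimum and let the permutation send each letter to the next one
in its block, and the last letter of the block to its first one.  A descent of
the word lies inside a block, because a block ends with a letter smaller than
all later ones, and closing up a block is never a step down.  So the descents of
the word start at exactly the letters that the permutation moves down, and have
the lengths of these moves ([drop_len_word_perm]).  Since a permutation goes up as much as it goes
down, DescLen of the word is ExcLen of the permutation ([ExcLen_drop_len]).
The first block ends with the least letter, whose image is therefore the first
letter of the word ([word_perm_least]).

Only the sign is wrong.  By [odd_word_perm], a first letter with r smaller
letters after it contributes 1 to the parity of [word_perm] when r > 0 and 0
otherwise, whereas it is the first entry of r inversions of the word.  The two
contributions differ when r is even and at least 2.  The first letter then
exceeds the two least letters of the rest, and exchanging the values of these
two reverses a single pair but preserves DescLen: every other letter, including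
the first, lies above both, so if the two differ by d, the descent into one
place becomes longer by d and the descent into the other shorter by d
([desc_len_swap_least], which also covers adjacent places).  The map [adjust] makes this exchange for every suffix
that needs it.  It keeps the first letter and DescLen, and the inversions of
[adjust w] have the parity of [word_perm w] ([odd_inv_adjust]).

Both maps are injective on the words with given letters, hence bijective on the
words of permutations, and the theorem holds for [word_perm] composed with the
inverse of [adjust]. *)

(** * Words and their two least letters *)

Section Words.
Variable n : nat.
Implicit Types (a b x y z : 'I_n.+1) (v w : seq 'I_n.+1).

Definition leq_letter : rel 'I_n.+1 := fun x y => x <= y.

Definition least w := nth ord0 (sort leq_letter w) 0.
Definition second_least w := nth ord0 (sort leq_letter w) 1.

Lemma sorted_letters w : sorted leq_letter (sort leq_letter w).
Proof. by apply: sort_sorted => x y; apply: leq_total. Qed.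

Lemma leq_letter_trans : transitive leq_letter.
Proof. by move=> y x z; apply: leq_trans. Qed.

Lemma perm_sort_letters v w :
  perm_eq v w -> sort leq_letter v = sort leq_letter w.
Proof.
apply/perm_sortP; [by move=> x y; apply: leq_total| exact: leq_letter_trans|].
by move=> x y; rewrite /leq_letter -eqn_leq => /eqP/val_inj.
Qed.

Lemma perm_least v w : perm_eq v w -> least v = least w.
Proof. by rewrite /least => /perm_sort_letters->. Qed.

Lemma perm_second_least v w : perm_eq v w -> second_least v = second_least w.
Proof. by rewrite /second_least => /perm_sort_letters->. Qed.

Lemma least_mem a w : least (a :: w) \in a :: w.
Proof. by rewrite -(mem_sort leq_letter) mem_nth // size_sort. Qed.

Lemma least_leq w x : x \in w -> least w <= x.
Proof.
rewrite /least -(mem_sort leq_letter); have := sorted_letters w.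
case: (sort _ w) => [|y s] //= /(order_path_min leq_letter_trans)/allP le_ys.
by rewrite inE => /predU1P[-> //|/le_ys].
Qed.

Lemma second_leastP w : uniq w -> 1 < size w ->
  [/\ least w \in w, second_least w \in w, least w < second_least w &
      forall z, z \in w ->
        [\/ z = least w, z = second_least w | second_least w < z]].
Proof.
move=> Uw; rewrite -(size_sort leq_letter w) => w_gt1.
have mem_s := mem_sort leq_letter w.
have := sorted_letters w; have := Uw; rewrite -(sort_uniq leq_letter).
rewrite /least /second_least; move: w_gt1 mem_s.
case: (sort _ w) => [|x [|y s]] // _ mem_s /=.
rewrite inE negb_or => /andP[/andP[xDy _] /andP[yNs _]] /andP[le_xy].
move=> /(order_path_min leq_letter_trans)/allP le_ys; split.
- by rewrite -mem_s mem_head.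
- by rewrite -mem_s !inE eqxx orbT.
- by rewrite ltn_neqAle xDy.
move=> z; rewrite -mem_s !inE => /or3P[/eqP->|/eqP->|z_s].
- by constructor 1.
- by constructor 2.
constructor 3; rewrite ltn_neqAle; move: (le_ys _ z_s); rewrite /leq_letter => ->.
by rewrite andbT; apply: contraNneq yNs => /val_inj ->.
Qed.

(** DescLen of the nonempty word [a :: w]: truncation makes ascents count 0. *)
Fixpoint word_desc_len a w : nat :=
  if w is b :: w' then (a - b) + word_desc_len b w' else 0.

Fixpoint word_inv w : nat :=
  if w is a :: w' then count (fun b : 'I_n.+1 => b < a) w' + word_inv w' else 0.

Lemma perm_map_tperm x y v :
  uniq v -> x \in v -> y \in v -> perm_eq (map (tperm x y) v) v.
Proof.
move=> Uv xv yv; apply: uniq_perm => // [|z].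
  by rewrite map_inj_uniq //; apply: perm_inj.
rewrite -{1}[z](tpermK x y) (mem_map perm_inj).
by case: tpermP => [->|->|] //; rewrite ?xv ?yv.
Qed.

(** * Exchanging the two least letters *)

Section SwapLeast.
Variables x y : 'I_n.+1.
Hypothesis lt_xy : x < y.
Let low z := [\/ z = x, z = y | y < z].

Lemma low_tperm z : low z ->
  [\/ z = x /\ tperm x y z = y, z = y /\ tperm x y z = x
    | y < z /\ tperm x y z = z].
Proof.
case=> [->|->|lt_yz]; [constructor 1|constructor 2|constructor 3].
- by rewrite tpermL.
- by rewrite tpermR.
by rewrite tpermD // -val_eqE /=; lia.
Qed.

(** A step down from a letter above [y] becomes shorter by [y - x] if it goes to
[x] and longer by [y - x] if it goes to [y]; steps out of [x] or [y] are
descents only from [y] to [x] when adjacent.  The counts record which of the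
two letters occur after the first place, so that the equation holds for every
suffix and passes through the induction; they agree when [a] lies above both
letters and both occur. *)
Lemma desc_len_swap_least a v :
    uniq (a :: v) -> (forall z, z \in a :: v -> low z) ->
  word_desc_len (tperm x y a) (map (tperm x y) v) + (y - x) * count_mem x v =
  word_desc_len a v + (y - x) * count_mem y v.
Proof.
elim: v a => [|b v IHv] a //= /andP[]; rewrite inE negb_or => /andP[aDb _] Ubv.
move=> lo; have lob z : z \in b :: v -> low z.
  by move=> zbv; apply: lo; rewrite inE zbv orbT.
have := IHv b Ubv lob; move: aDb; rewrite -!val_eqE /= => aDb.
have := low_tperm (lo a (mem_head _ _)).
have := low_tperm (lob b (mem_head _ _)).
by case=> [] [? ->] [] [? ->] IH; subst; lia.
Qed.

(** The pair of places of [x] and [y] is the only one whose order is reversed,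
as no other letter lies between them in value. *)
Lemma odd_inv_swap_least v : uniq v -> (forall z, z \in v -> low z) ->
  odd (word_inv (map (tperm x y) v)) =
  odd (word_inv v) (+) ((x \in v) && (y \in v)).
Proof.
elim: v => [|b v IHv] //= /andP[bNv Uv] lo.
have lov z : z \in v -> low z by move=> zv; apply: lo; rewrite inE zv orbT.
rewrite !oddD {}IHv // count_map !inE.
have cnt (p q : pred 'I_n.+1) : (forall z, z \in v -> p z = q z) ->
  count p v = count q v by move=> /eq_in_count.
have := low_tperm (lo b (mem_head _ _)); case=> [] [def_b def_tb].
- rewrite (cnt _ (pred1 y)) => [|z zv]; last first.
    rewrite /= def_tb; have := low_tperm (lov z zv).
    by rewrite -val_eqE /=; case=> [] [? ->]; subst; lia.
  rewrite (cnt (fun z : 'I_n.+1 => z < b) pred0) => [|z zv]; last first.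
    by have := lov z zv; case=> /= ?; subst; lia.
  rewrite count_pred0 count_uniq_mem // def_b eqxx -def_b (negbTE bNv) def_b.
  rewrite -val_eqE /=; have -> : (y == x :> nat) = false by lia.
  by rewrite oddb addbF addbC.
- rewrite (cnt _ pred0) => [|z zv]; last first.
    rewrite /= def_tb; have := low_tperm (lov z zv).
    by case=> [] [? ->]; subst; lia.
  rewrite (cnt (fun z : 'I_n.+1 => z < b) (pred1 x)) => [|z zv]; last first.
    by have := lov z zv; rewrite /= -val_eqE /=; case=> /= ?; subst; lia.
  rewrite count_pred0 count_uniq_mem // def_b eqxx -def_b (negbTE bNv) def_b.
  rewrite -val_eqE /=; have -> : (x == y :> nat) = false by lia.
  by rewrite oddb andbT andbF addbF addbC addKb.
rewrite (cnt _ (fun z : 'I_n.+1 => z < b)) => [|z zv]; last first.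
  rewrite /= def_tb; have := low_tperm (lov z zv).
  by case=> [] [? ->]; subst; lia.
rewrite -!val_eqE /=.
have -> : (x == b :> nat) = false by lia.
have -> : (y == b :> nat) = false by lia.
by rewrite addbA.
Qed.

End SwapLeast.

(** * From words to permutations *)

(** The permutation whose cycles are the blocks of the word cut after its
right-to-left minima.  In recursive form, a first letter that is not the least
one is inserted in the cycle of the least letter, just after it; a least first
letter is a block of its own, and the transposition is the identity. *)
Fixpoint word_perm w : 'S_n.+1 :=
  if w is a :: w' then (tperm (least w) a * word_perm w')%g else 1%g.

Lemma word_perm_out w z : z \notin w -> word_perm w z = z.
Proof.
elim: w => [|a w IHw]; first by rewrite perm1.
move=> zNaw; rewrite [word_perm _]/= permM tpermD.
- by apply: IHw; move: zNaw; rewrite inE negb_or => /andP[].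
- by apply: contraNneq zNaw => <-; apply: least_mem.
by apply: contraNneq zNaw => <-; apply: mem_head.
Qed.

Lemma word_perm_least a w :
  uniq (a :: w) -> word_perm (a :: w) (least (a :: w)) = a.
Proof. by case/andP=> aNw _; rewrite [word_perm _]/= permM tpermL word_perm_out. Qed.

(** The first letter is recovered as the image of the least one, which depends
only on the set of letters; cancelling the transposition leaves the rest. *)
Lemma word_perm_inj v w :
  uniq v -> perm_eq v w -> word_perm v = word_perm w -> v = w.
Proof.
elim: v w => [|a v IHv] [|b w] // Uav.
- by move=> /perm_size.
- by move=> /perm_size.
move=> Evw Ep; have Ubw : uniq (b :: w) by rewrite -(perm_uniq Evw).
have Eab : a = b.
  by rewrite -(word_perm_least Uav) Ep (perm_least Evw) (word_perm_least Ubw).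
subst b; move: Ep; rewrite /= (perm_least Evw) => /mulgI Ep.
by congr cons; apply: IHv => //; [case/andP: Uav | rewrite -(perm_cons a)].
Qed.

Definition drop_len (s : 'S_n.+1) : nat := \sum_(i < n.+1) (i - s i).

(** The differences [s i - i] add up to 0. *)
Lemma ExcLen_drop_len s : ExcLen s = drop_len s.
Proof.
have -> : ExcLen s = \sum_(i < n.+1) (s i - i).
  rewrite /ExcLen big_mkcond; apply: eq_bigr => i _.
  by case: ltnP => // /eqP->.
have sum_s : \sum_(i < n.+1) s i = \sum_(i < n.+1) i.
  by rewrite [RHS](reindex_inj (@perm_inj _ s)).
apply/eqP; rewrite -(eqn_add2r (\sum_(i < n.+1) i)) -{2}sum_s -!big_split /=.
by apply/eqP/eq_bigr => i _; lia.
Qed.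

(** A first letter [a] that is not least is inserted between the least letter [m]
and its image, the next letter [b] of the word.  The step from [m] to [b], which
is no drop, gives way to a step up from [m] to [a] and a step from [a] to [b],
which is a drop exactly when the word starts with a descent. *)
Lemma drop_len_word_perm a w :
  uniq (a :: w) -> drop_len (word_perm (a :: w)) = word_desc_len a w.
Proof.
elim: w a => [|b w IHw] a Uw.
  rewrite [word_perm _]/= tperm1 mulg1.
  by rewrite /drop_len big1 // => i _; rewrite perm1 subnn.
have [aNw Ubw] := andP Uw; rewrite [RHS]/= -IHw //.
set m := least (a :: b :: w); set s := word_perm (b :: w).
have m_le z : z \in a :: b :: w -> m <= z by apply: least_leq.
have -> : drop_len (word_perm (a :: b :: w)) = \sum_i (tperm m a i - s i).
  rewrite /drop_len [word_perm _]/= (reindex_inj (@perm_inj _ (tperm m a))).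
  by apply: eq_bigr => i _; rewrite permM tpermK.
(* After the reindexing, the summand at m is the drop from a to the old image
   of m, and the other summands are those for s. *)
rewrite /drop_len (bigD1 m) //= [in RHS](bigD1 m) //= tpermL addnA; congr (_ + _).
  have := least_mem a (b :: w); rewrite -/m inE => /predU1P[def_m|m_bw].
    have : m <= b by apply: m_le; rewrite !inE eqxx orbT.
    by rewrite def_m -subn_eq0 => /eqP->.
  have -> : m = least (b :: w).
    apply/val_inj/eqP; rewrite eqn_leq [X in _ && X]least_leq // andbT.
    by apply: m_le; rewrite inE least_mem orbT.
  rewrite word_perm_least //; have := least_leq (mem_head b w).
  by rewrite -subn_eq0 => /eqP->; rewrite addn0.
apply: eq_bigr => i iDm; case: tpermP iDm => // [->|->]; first by rewrite eqxx.
rewrite /s word_perm_out // => _.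
by have := m_le a (mem_head _ _); lia.
Qed.

Lemma odd_word_perm a w :
  odd_perm (word_perm (a :: w)) =
  (0 < count (fun b : 'I_n.+1 => b < a) w) (+) odd_perm (word_perm w).
Proof.
rewrite [word_perm _]/= odd_mul_tperm; congr (_ (+) _).
rewrite -has_count; apply/idP/hasP => [mDa|[b bw lt_ba]].
  exists (least (a :: w)).
    by move: (least_mem a w); rewrite inE (negbTE mDa).
  by move: mDa (least_leq (mem_head a w)); rewrite -val_eqE /=; lia.
have : least (a :: w) <= b by apply: least_leq; rewrite inE bw orbT.
by rewrite -val_eqE /=; lia.
Qed.

(** * Correcting the parity of the inversions *)

(** The condition under which a first letter [a] contributes differently to the
parity of the inversions and to that of [word_perm]. *)
Definition swap_needed a v :=
  let r := count (fun b : 'I_n.+1 => b < a) v in ~~ odd r && (0 < r).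

Definition adjust_tail a v :=
  if swap_needed a v then map (tperm (least v) (second_least v)) v else v.

Lemma swap_neededP a v : uniq v -> swap_needed a v ->
  1 < size v /\ second_least v < a.
Proof.
rewrite /swap_needed; set r := count _ v => Uv r_even.
have r_gt1 : 1 < r by case: r r_even => [|[]].
have v_gt1 : 1 < size v by apply: leq_trans r_gt1 (count_size _ _).
split=> //; have [_ _ _ lo] := second_leastP Uv v_gt1.
rewrite ltnNge; apply/negP => le_a.
have : r <= count_mem (least v) v.
  rewrite /r -!size_filter; apply: uniq_leq_size; first exact: filter_uniq.
  move=> z; rewrite !mem_filter => /andP[lt_za zv]; rewrite zv andbT /=.
  by case: (lo z zv) => [->|?|?]; rewrite ?eqxx //; subst; lia.
by rewrite count_uniq_mem //; case: (_ \in _); lia.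
Qed.

Lemma perm_adjust_tail a v : uniq v -> perm_eq (adjust_tail a v) v.
Proof.
rewrite /adjust_tail; case: ifP => // need Uv.
have [v_gt1 _] := swap_neededP Uv need.
have [xv yv _ _] := second_leastP Uv v_gt1.
exact: perm_map_tperm.
Qed.

Lemma desc_len_adjust_tail a v :
  uniq (a :: v) -> word_desc_len a (adjust_tail a v) = word_desc_len a v.
Proof.
rewrite /adjust_tail; case: ifP => // need Uav; have /andP[_ Uv] := Uav.
have [v_gt1 lt_ya] := swap_neededP Uv need.
have [xv yv lt_xy lo] := second_leastP Uv v_gt1.
have loa z : z \in a :: v ->
    [\/ z = least v, z = second_least v | second_least v < z].
  by rewrite inE => /predU1P[->|/lo //]; constructor 3.
have := desc_len_swap_least lt_xy Uav loa.
rewrite !count_uniq_mem // xv yv => /addIn.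
by rewrite tpermD // -val_eqE /=; lia.
Qed.

Lemma odd_inv_adjust_tail a v : uniq v ->
  odd (word_inv (adjust_tail a v)) = odd (word_inv v) (+) swap_needed a v.
Proof.
rewrite /adjust_tail; case: ifP => need Uv; last by rewrite addbF.
have [v_gt1 _] := swap_neededP Uv need.
have [xv yv lt_xy lo] := second_leastP Uv v_gt1.
by rewrite (odd_inv_swap_least lt_xy) // xv yv.
Qed.

(** Words with the same letters undergo the same exchange of values. *)
Lemma adjust_tail_inj a v w :
  perm_eq v w -> adjust_tail a v = adjust_tail a w -> v = w.
Proof.
move=> Evw; rewrite /adjust_tail /swap_needed (seq.permP Evw).
rewrite (perm_least Evw) (perm_second_least Evw).
by case: ifP => // _; apply/inj_map/perm_inj.
Qed.

Definition adjust w := foldr (fun a v => a :: adjust_tail a v) [::] w.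

Lemma perm_adjust w : uniq w -> perm_eq (adjust w) w.
Proof.
elim: w => //= a w IHw /andP[_ Uw]; rewrite perm_cons.
apply: perm_trans (IHw Uw); apply: perm_adjust_tail.
by rewrite (perm_uniq (IHw Uw)).
Qed.

Lemma adjust_inj v w :
  uniq v -> perm_eq v w -> adjust v = adjust w -> v = w.
Proof.
elim: v w => [|a v IHv] [|b w] // Uav Evw; try by have := perm_size Evw.
have [_ Uv] := andP Uav.
case=> Eab; move: Evw; rewrite -{}Eab perm_cons => Evw Et.
have Uw : uniq w by rewrite -(perm_uniq Evw).
congr cons; apply: IHv => //; apply: adjust_tail_inj Et.
apply: perm_trans (perm_adjust Uv) (perm_trans Evw _).
by rewrite perm_sym perm_adjust.
Qed.

Lemma desc_len_adjust a w : uniq (a :: w) ->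
  word_desc_len a (behead (adjust (a :: w))) = word_desc_len a w.
Proof.
elim: w a => // b w IHw a Uabw; have [aNbw Ubw] := andP Uabw.
have Ebw := perm_adjust (Ubw : uniq (b :: w)); rewrite [behead _]/= desc_len_adjust_tail.
  by rewrite -[RHS]/(_ + word_desc_len b w) -IHw.
by rewrite cons_uniq (perm_mem Ebw) (perm_uniq Ebw).
Qed.

Lemma odd_inv_adjust w : uniq w ->
  odd (word_inv (adjust w)) = odd_perm (word_perm w).
Proof.
elim: w => [|a w IHw] Uaw; first by rewrite odd_perm1.
have /andP[_ Uw] := Uaw; have Ew := perm_adjust Uw.
rewrite odd_word_perm -IHw //= oddD.
rewrite odd_inv_adjust_tail ?(perm_uniq Ew) // /swap_needed.
rewrite !(seq.permP (perm_adjust_tail _ _)) ?(perm_uniq Ew) // (seq.permP Ew).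
by case: (count _ _) => [|r] /=; case: odd => //=; case: odd.
Qed.

End Words.

(** * Words of permutations and the parity of inversions *)

Definition inv_count k (f : 'I_k -> nat) :=
  \sum_(i < k) \sum_(j < k) ((i < j) && (f j < f i)).

Lemma inv_count_recl k (f : 'I_k.+1 -> nat) :
  inv_count f =
  \sum_(j < k) (f (lift ord0 j) < f ord0) + inv_count (f \o lift ord0).
Proof.
rewrite /inv_count big_ord_recl big_ord_recl add0n; congr (_ + _).
by apply: eq_bigr => i _; rewrite big_ord_recl add0n.
Qed.

Lemma perm_inv_count n (pi : 'S_n.+1) :
  Defs.perm_inv pi = inv_count (fun i => pi i).
Proof.
rewrite /Defs.perm_inv -sum1_card /inv_count pair_bigA /= big_mkcond /=.
by apply: eq_bigr => -[i j] _; rewrite inE /=; case: (_ && _).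
Qed.

Lemma word_inv_count n k (f : 'I_k -> 'I_n.+1) :
  word_inv (map f (enum 'I_k)) = inv_count (fun i => f i).
Proof.
elim: k f => [|k IHk] f; first by rewrite enum_ord0 /inv_count big_ord0.
rewrite enum_ordSl inv_count_recl /= -map_comp IHk; congr (_ + _).
rewrite count_map -sum1_count big_mkcond big_enum /=.
by apply: eq_bigr => i _; case: ifP.
Qed.

Lemma sum_ltn_ord k h : \sum_(j < k) (j < h) = minn k h.
Proof.
elim: k => [|k IHk]; first by rewrite big_ord0 min0n.
by rewrite big_ord_recr IHk /=; lia.
Qed.

Lemma ltn_bump_self h j : (bump h j < h) = (j < h).
Proof. by rewrite /bump; lia. Qed.

Lemma ltn_bump h i j : (bump h i < bump h j) = (i < j).
Proof. by rewrite /bump; lia. Qed.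

Lemma perm_liftP k (s : 'S_k.+1) : exists t, s = lift_perm ord0 (s ord0) t.
Proof.
have /fin_all_exists[g sE] i : exists j, s (lift ord0 i) = lift (s ord0) j.
  have [|j -> _] := @unlift_some _ (s ord0) (s (lift ord0 i)).
    by rewrite (inj_eq perm_inj).
  by exists j.
have g_inj : injective g.
  by move=> i j Eg; apply/(@lift_inj _ ord0)/(@perm_inj _ s); rewrite !sE Eg.
exists (perm g_inj); apply/permP=> i; case: (unliftP ord0 i) => [j|] ->.
  by rewrite lift_perm_lift permE.
by rewrite lift_perm_id.
Qed.

(** By induction on [k]: removing the first value [h] removes [h] inversions,
since exactly the [h] smaller values come after it, and the parity of
[lift_perm ord0 h t] is that of [t] plus [h]. *)
Lemma odd_inv_count k (s : 'S_k) : odd (inv_count (fun i => s i)) = odd_perm s.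
Proof.
elim: k s => [|k IHk] s.
  by rewrite /inv_count big_ord0 (_ : s = 1%g) ?odd_perm1 //; apply/permP => -[].
have [t ->] := perm_liftP s; move: (s ord0) => h.
rewrite odd_lift_perm inv_count_recl oddD -IHk addFb; congr (odd _ (+) odd _).
  under eq_bigr => j _ do rewrite lift_perm_lift lift_perm_id.
  rewrite (reindex_inj (@perm_inj _ t^-1)) /=.
  under eq_bigr => j _ do rewrite permKV ltn_bump_self.
  by rewrite sum_ltn_ord; move/minn_idPr: (ltn_ord h : h <= k) => ->.
apply: eq_bigr => i _; apply: eq_bigr => j _ /=.
by rewrite !lift_perm_lift /= ltn_bump.
Qed.

Lemma perm_sign_odd n (pi : 'S_n.+1) : perm_sign pi = ((-1) ^+ odd_perm pi)%R.
Proof. by rewrite /perm_sign perm_inv_count -odd_inv_count GRing.signr_odd. Qed.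

Lemma DescLen_codom n (pi : 'S_n.+1) :
  DescLen pi = word_desc_len (pi ord0) (behead (codom pi)).
Proof.
suff H k (f : 'I_k.+1 -> 'I_n.+1) :
    word_desc_len (f ord0) (behead (codom f)) =
    \sum_(i < k) (f (widen_ord (leqnSn k) i) - f (lift ord0 i)).
  rewrite H /DescLen big_mkcond; apply: eq_bigr => i _.
  by case: ltnP => // /eqP->.
elim: k f => [|k IHk] f; first by rewrite codomE enum_ordSl enum_ord0 big_ord0.
rewrite codomE enum_ordSl /= -map_comp -codomE big_ord_recl.
have := IHk (f \o lift ord0); rewrite [codom _]codomE {1 2}enum_ordSl /= => ->.
congr (_ + _); first by congr (f _ - _); apply/val_inj.
by apply: eq_bigr => i _; congr (f _ - _); apply/val_inj.
Qed.

Lemma codom_perm_ex n (w : seq 'I_n.+1) :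
  perm_eq w (enum 'I_n.+1) -> exists s : 'S_n.+1, codom s = w.
Proof.
move=> Ew; have Uw : uniq w by rewrite (perm_uniq Ew) enum_uniq.
have sz_w : size w = n.+1 by rewrite (perm_size Ew) size_enum_ord.
have f_inj : injective (fun i : 'I_n.+1 => nth ord0 w i).
  by move=> i j /eqP; rewrite nth_uniq ?sz_w // => /eqP/val_inj.
exists (perm f_inj); rewrite codomE (eq_map (permE f_inj)).
rewrite (map_comp (nth ord0 w) val) val_enum_ord.
by have := mkseq_nth ord0 w; rewrite /mkseq sz_w.
Qed.

Lemma perm_codom n (s : 'S_n.+1) : perm_eq (codom s) (enum 'I_n.+1).
Proof.
rewrite codomE; apply: uniq_perm.
- by rewrite map_inj_uniq ?enum_uniq //; apply: perm_inj.
- exact: enum_uniq.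
by move=> x; rewrite -{1}[x](permKV s) (mem_map perm_inj) !mem_enum.
Qed.

Lemma codom_perm_inj n : injective (fun s : 'S_n.+1 => codom s).
Proof.
move=> s t; rewrite !codomE => /eq_in_map E; apply/permP=> i.
by apply: E; rewrite mem_enum.
Qed.

Lemma codom_ord0 n (s : 'S_n.+1) : codom s = s ord0 :: behead (codom s).
Proof. by rewrite codomE enum_ordSl. Qed.

Lemma perm_inv_codom n (s : 'S_n.+1) : Defs.perm_inv s = word_inv (codom s).
Proof. by rewrite perm_inv_count codomE word_inv_count. Qed.

(** * The bijection *)

Theorem theorem8 (n : nat) :
  exists Phi : 'S_n.+1 -> 'S_n.+1,
    bijective Phi /\
    forall pi : 'S_n.+1,
      (first_letter (Phi pi), perm_sign (Phi pi), ExcLen (Phi pi)) =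
      (first_letter pi, perm_sign pi, DescLen pi).
Proof.
have Uc (s : 'S_n.+1) : uniq (codom s).
  by rewrite (perm_uniq (perm_codom s)) enum_uniq.
have Ecc (s t : 'S_n.+1) : perm_eq (codom s) (codom t).
  by apply: perm_trans (perm_codom s) _; rewrite perm_sym perm_codom.
have /fin_all_exists[Psi codom_Psi] (s : 'S_n.+1) :
    exists t : 'S_n.+1, codom t = adjust (codom s).
  by apply: codom_perm_ex; apply: perm_trans (perm_adjust (Uc s)) (perm_codom s).
have Psi_inj : injective Psi.
  move=> s t Est; apply: codom_perm_inj; apply: adjust_inj => //.
  by rewrite -!codom_Psi Est.
pose Theta (s : 'S_n.+1) := word_perm (codom s).
have Theta_inj : injective Theta.
  by move=> s t Est; apply: codom_perm_inj; apply: word_perm_inj.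
exists (fun pi => Theta (invF Psi_inj pi)); split.
  apply: bij_comp (injF_bij Theta_inj) _.
  exact: (Bijective (f_invF Psi_inj) (invF_f Psi_inj)).
move=> pi /=; move: (invF Psi_inj pi) (f_invF Psi_inj pi) => s <-.
have Uaw : uniq (s ord0 :: behead (codom s)) by rewrite -codom_ord0.
have def0 : least (codom s) = ord0.
  have : least (codom s) <= @ord0 n.
    by apply/least_leq/codomP; exists (s^-1%g ord0); rewrite permKV.
  by rewrite leqn0 => /eqP ?; apply: val_inj.
have Psi0 : Psi s ord0 = s ord0.
  by have := codom_Psi s; rewrite codom_ord0 [codom s]codom_ord0 => -[].
congr (_, _, _).
- have := word_perm_least Uaw; rewrite -codom_ord0 def0 -/(Theta s) => Theta0.
  by rewrite /first_letter Theta0 Psi0.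
- rewrite perm_sign_odd -odd_inv_adjust // -codom_Psi -perm_inv_codom.
  by rewrite GRing.signr_odd.
rewrite ExcLen_drop_len /Theta codom_ord0 drop_len_word_perm //.
by rewrite DescLen_codom Psi0 codom_Psi [codom s]codom_ord0 desc_len_adjust.
Qed.
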